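(* Let $G$ be a finite non-nilpotent soluble group, write $\sigma=\sigma(G)$, and suppose $\mathfrak{m}(G)<2\sigma-1$. Then $\sigma\neq 3$ and $$G/\Phi(G)\cong (E_{\sigma-1}\rtimes\mathbb{Z}_t)\times\mathbb{Z}_{p_1\cdots p_{\ell}},$$ where $t$ is a positive integer dividing $|\mathrm{Aut}(E_{\sigma-1})|$, $p_1,\dots,p_\ell$ are distinct primes coprime to $t$, and $\ell=\mathfrak{m}(G)-\mathfrak{m}(\mathbb{Z}_t)-\sigma+1$.
   Context: For a finite group $G$, $\mathfrak{m}(G)$ is the number of maximal subgroups of $G$, and, for $G$ non-cyclic, $\sigma(G)$ is the least positive integer $n$ such that $G$ is the union of $n$ proper subgroups. $\Phi(G)$ is the Frattini subgroup. $E_n$ denotes an elementary abelian group of order $n$ (so $n$ is a prime power), and $\mathbb{Z}_n$ the cyclic group of order $n$. If $\ell=0$, the product $p_1\cdots p_\ell$ is $1$. *)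

(* Defs.v *)
From mathcomp Require Import all_boot all_order all_fingroup all_algebra all_solvable.

Set Implicit Arguments.
Unset Strict Implicit.
Unset Printing Implicit Defensive.

Import GroupScope.

Section MaximalSubgroupsAndCoverings.

Variables (gT : finGroupType) (G : {group gT}).

Definition num_maximal : nat := #|[set M : {group gT} | maximal M G]|.

(* The H i may repeat; this does not affect the least such n. *)
Definition union_of_proper (n : nat) : bool :=
  [exists H : {ffun 'I_n -> {group gT}},
    [forall i, H i \proper G] && (\bigcup_(i < n) H i == G :> {set gT})].

Lemma covering_number_ex :
  exists n, cyclic G || (0 < n) && union_of_proper n.
Proof.
case: (boolP (cyclic G)) => [_ | ncG]; first by exists 0.
exists #|G| => /=; rewrite cardG_gt0 /=.
apply/existsP; exists [ffun i => <[enum_val i]>%G].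
have sG (i : 'I_#|G|) : <[enum_val i]> \subset G by rewrite cycle_subG enum_valP.
apply/andP; split.
  apply/forallP=> i; rewrite ffunE properEneq sG andbT.
  by apply: contra ncG => /eqP <-; apply: cycle_cyclic.
rewrite eqEsubset; apply/andP; split.
  by apply/bigcupsP=> i _; rewrite ffunE; apply: sG.
apply/subsetP=> x Gx; apply/bigcupP; exists (enum_rank_in Gx x) => //.
by rewrite ffunE /= enum_rankK_in // cycle_id.
Qed.

(* sigma(G) for non-cyclic G; a cyclic group is not a union of proper
   subgroups, and then the value is 0 by convention. *)
Definition covering_number : nat := ex_minn covering_number_ex.

End MaximalSubgroupsAndCoverings.

(* Main.v *)
Require Import Defs.
From mathcomp Require Import all_boot all_order all_fingroup all_algebra all_solvable.
From mathcomp Require Import zify.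

Set Implicit Arguments.
Unset Strict Implicit.
Unset Printing Implicit Defensive.

Import GroupScope.

(* Let n be the number of normal maximal subgroups of G.  A non-normal maximal
   subgroup M of index q has q conjugates.  If q is least among the indices of
   the non-normal maximal subgroups, then the conjugates of M and the normal
   maximal subgroups cover G, so sigma <= q + n: an element of no conjugate of M
   centralises a nontrivial v in the socle, of order q, of G / core(M), and the
   centraliser of v has index less than q, so it lies only in normal maximal
   subgroups.  On the other hand, if Q / core(Q) is abelian, then the conjugates
   of Q together with one further subgroup cover G, so sigma <= |G : Q| + 1; a Q
   with largest possible core has Q / core(Q) nilpotent, and if it is not cyclic
   then G has an elementary abelian quotient of order r^2 with r <= |G : Q|, hence
   sigma <= r + 1 <= n.  Comparing these bounds with the number of maximal
   subgroups shows that when m(G) < 2 sigma - 1 all the non-normal maximal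
   subgroups are conjugate to Q, Q / core(Q) and G / G' are cyclic, and
   sigma = q + 1.  Modulo the Frattini subgroup, G = G' ><| Q with Q cyclic and
   core(Q) a central Hall subgroup of Q of squarefree order. *)

(** * Bounds for the covering number, and passage to quotients *)

Section CoveringNumber.

Variable gT : finGroupType.
Implicit Types (G H K M N P Q V : {group gT}).

Lemma covering_number_le G (A : {set {group gT}}) :
    ~~ cyclic G -> (forall H, H \in A -> H \proper G) ->
    (forall x, x \in G -> exists2 H, H \in A & x \in gval H) ->
  covering_number G <= #|A|.
Proof.
move=> ncG prA covA; rewrite /covering_number; case: ex_minnP => n _; apply.
have [H0 AH0 _] := covA 1 (group1 G).
rewrite (negPf ncG) /=; apply/andP; split; first by apply/card_gt0P; exists H0.
apply/existsP; exists [ffun i : 'I_#|A| => enum_val i].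
apply/andP; split; first by apply/forallP=> i; rewrite ffunE prA ?enum_valP.
rewrite eqEsubset; apply/andP; split.
  by apply/bigcupsP=> i _; rewrite ffunE proper_sub ?prA ?enum_valP.
apply/subsetP=> x /covA[H AH Hx]; apply/bigcupP.
by exists (enum_rank_in AH H); rewrite // ffunE enum_rankK_in.
Qed.

(** Pigeonhole: sending each element of [X] to the index of a covering member that contains it is
    injective. *)
Lemma covering_number_ge G (X : {set gT}) :
    ~~ cyclic G -> X \subset G ->
    (forall x y P, x \in X -> y \in X -> P \proper G ->
       x \in P -> y \in P -> x = y) ->
  #|X| <= covering_number G.
Proof.
move=> ncG sXG indX; rewrite /covering_number; case: ex_minnP => n.
rewrite (negPf ncG) /= => /andP[n_gt0 /existsP[H /andP[/forallP prH /eqP defG]]] _.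
case: n n_gt0 H prH defG => // n _ H prH defG.
pose f x : 'I_n.+1 := odflt ord0 [pick i | x \in H i].
have fP x : x \in X -> x \in H (f x).
  move=> Xx; rewrite /f; case: pickP => //= Hx.
  have: x \in G by apply: (subsetP sXG).
  by rewrite -defG => /bigcupP[i _ Hix]; have := Hx i; rewrite Hix.
rewrite -(card_in_imset (f := f)) => [|x y Xx Xy eqf].
  by rewrite -[leqRHS]card_ord; apply: max_card.
by apply: (indX x y (H (f x))) => //; rewrite ?fP // eqf fP.
Qed.

Lemma cosetpre_group_inj N :
  injective (fun Hb : {group coset_of N} => (coset N @*^-1 Hb)%G).
Proof.
move=> Hb Lb /(congr1 val)/= eqHL; apply/val_inj.
by rewrite /= -(cosetpreK (gval Hb)) eqHL cosetpreK.
Qed.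

Lemma proper_quotient_cosetpre G N (Hb : {group coset_of N}) :
  N <| G -> (coset N @*^-1 Hb \proper G) = (Hb \proper G / N).
Proof. by move=> nsNG; rewrite -{1}(quotientGK nsNG) morphpre_proper ?sub_im_coset. Qed.

Lemma maximal_quotient_cosetpre G N (Hb : {group coset_of N}) :
  N <| G -> maximal (coset N @*^-1 Hb) G = maximal Hb (G / N).
Proof. by move=> nsNG; rewrite -cosetpre_maximal /= quotientGK. Qed.

Lemma normal_quotient_cosetpre G N (Hb : {group coset_of N}) :
  N <| G -> (coset N @*^-1 Hb <| G) = (Hb <| G / N).
Proof. by move=> nsNG; rewrite -{1}(quotientGK nsNG) cosetpre_normal. Qed.

Lemma index_quotient_cosetpre G N (Hb : {group coset_of N}) :
  N <| G -> #|G : coset N @*^-1 Hb| = #|G / N : Hb|.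
Proof. by move=> nsNG; rewrite -{1}(quotientGK nsNG) index_cosetpre. Qed.

Lemma num_maximal_quotient G N :
  N <| G -> num_maximal (G / N) = #|[set M : {group gT} | maximal M G & N \subset M]|.
Proof.
move=> nsNG; rewrite /num_maximal.
rewrite -(card_imset _ (@cosetpre_group_inj N)); apply/eq_card=> M; rewrite !inE.
apply/imsetP/andP => [[Mb] | [maxM sNM]].
  by rewrite inE => maxMb ->; rewrite maximal_quotient_cosetpre // sub_cosetpre.
have defM: M :=: coset N @*^-1 (M / N).
  by rewrite quotientGK // (normalS sNM (proper_sub (maxgroupp maxM))).
by exists (M / N)%G; [rewrite inE -maximal_quotient_cosetpre // -defM | apply/val_inj].
Qed.

Lemma num_maximal_quotient_Phi G : num_maximal (G / 'Phi(G)) = num_maximal G.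
Proof.
rewrite num_maximal_quotient ?Phi_normal //; apply: eq_card => M; rewrite !inE.
by apply: andb_idr => maxM; apply: Phi_sub_max.
Qed.

(** Preimages of a covering of the quotient cover [G]. Conversely, images of proper subgroups stay
    proper because the Frattini subgroup consists of non-generators. *)
Lemma covering_number_quotient_Phi G :
  covering_number (G / 'Phi(G)) = covering_number G.
Proof.
have ncyc: cyclic (G / 'Phi(G)) = cyclic G.
  by apply/idP/idP; [apply: Phi_quotient_cyclic | apply: quotient_cyclic].
rewrite /covering_number; apply/eqP; rewrite eqn_leq.
have nsFG := Phi_normal G.
apply/andP; split.
  case: (ex_minnP (covering_number_ex G)) => n ok_n _.
  case: ex_minnP => m _; apply; rewrite ncyc; case/orP: ok_n => [-> //|].
  case/andP=> -> /existsP[H /andP[/forallP prH /eqP defG]].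
  apply/orP; right; apply/existsP; exists [ffun i => (H i / 'Phi(G))%G].
  apply/andP; split.
    apply/forallP=> i; rewrite ffunE /= properEneq quotientS ?proper_sub // andbT.
    apply: contraTneq (prH i) => eqHG.
    have: 'Phi(G) <*> H i = G.
      have sHG := proper_sub (prH i).
      have nFH: H i \subset 'N('Phi(G)) by apply: subset_trans (normal_norm nsFG).
      apply/eqP; rewrite eqEsubset join_subG Phi_sub sHG /=.
      rewrite norm_joinEr // -quotientK // eqHG quotientGK //.
    by move/Phi_nongen; rewrite genGid => ->; rewrite properxx.
  apply/eqP/setP=> xb; apply/bigcupP/idP => [[i _] | ].
    by rewrite ffunE; apply/subsetP/quotientS/proper_sub.
  case/morphimP=> x Nx Gx ->; move: Gx; rewrite -{1}defG => /bigcupP[i _ Hx].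
  by exists i; rewrite // ffunE mem_quotient.
case: (ex_minnP (covering_number_ex (G / _))) => n ok_n _.
case: ex_minnP => m _; apply; rewrite -ncyc; case/orP: ok_n => [-> //|].
case/andP=> -> /existsP[H /andP[/forallP prH /eqP defG]].
apply/orP; right; apply/existsP; exists [ffun i => (coset 'Phi(G) @*^-1 H i)%G].
apply/andP; split.
  by apply/forallP=> i; rewrite ffunE proper_quotient_cosetpre.
apply/eqP/setP=> x; apply/bigcupP/idP => [[i _] | Gx].
  by rewrite ffunE; apply/subsetP/proper_sub; rewrite proper_quotient_cosetpre.
have Nx: x \in 'N('Phi(G)) by apply: (subsetP (normal_norm nsFG)).
have: coset 'Phi(G) x \in G / 'Phi(G) by apply: mem_quotient.
rewrite -defG => /bigcupP[i _ Hix]; exists i => //.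
by rewrite ffunE; apply/morphpreP.
Qed.

End CoveringNumber.

(** * Maximal subgroups, normality and nilpotency *)

Section Maximal.

Variable gT : finGroupType.
Implicit Types (G H K M N P Q V : {group gT}).

(** The trivial subgroup is maximal in [G / M], so any element of prime order generates this
    quotient. *)
Lemma normal_maximal_prime G M : maximal M G -> M <| G -> prime #|G : M|.
Proof.
move=> maxM nsMG.
rewrite -card_quotient ?normal_norm //.
rewrite -(quotient_maximal (normal_refl M) nsMG) trivg_quotient in maxM.
have [pr1 max1] := maxgroupP maxM.
have ntGM: (G / M)%G != 1%G.
  by apply/negP=> /eqP/(congr1 val)/= G1; rewrite G1 properxx in pr1.
have [G1 | [p p_pr /Cauchy[//|x Gx ox]]] := trivgVpdiv (G / M).
  by case/negP: ntGM; apply/eqP/val_inj.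
suffices ->: G / M = <[x]> by rewrite -orderE ox.
apply/eqP; rewrite eq_sym eqEproper cycle_subG Gx /=; apply/negP=> prx.
have /eqP := max1 _ prx (sub1G _).
by rewrite cycle_eq1 -order_eq1 ox => /eqP p1; rewrite p1 in p_pr.
Qed.

(** A cyclic group has just one subgroup of each order, so the index maps the maximal subgroups
    bijectively onto the prime divisors of the order. *)
Lemma num_maximal_cyclic G : cyclic G -> num_maximal G = size (primes #|G|).
Proof.
move=> cycG; have cGG := cyclic_abelian cycG.
rewrite /num_maximal cardE -(size_map (fun M : {group gT} => #|G : M|)).
apply/perm_size/uniq_perm; rewrite ?primes_uniq //.
  rewrite map_inj_in_uniq ?enum_uniq // => M L.
  rewrite !mem_enum !inE => maxM maxL eqML.
  have sMG := proper_sub (maxgroupp maxM); have sLG := proper_sub (maxgroupp maxL).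
  apply/eqP; rewrite -val_eqE /= (eq_subG_cyclic cycG) //.
  rewrite -(eqn_pmul2r (indexg_gt0 G M)).
  by rewrite Lagrange // eqML Lagrange.
move=> p; rewrite mem_primes cardG_gt0 /=; apply/mapP/andP => [[M]|[p_pr p_dv]].
  rewrite mem_enum inE => maxM ->; have sMG := proper_sub (maxgroupp maxM).
  by rewrite normal_maximal_prime ?dvdn_indexg // -sub_abelian_normal.
case/cyclicP: cycG => x defG.
have sxG: <[x ^+ p]> \subset G by rewrite cycle_subG defG mem_cycle.
have oxp: #|G : <[x ^+ p]>| = p.
  rewrite -divgS //= -orderE orderXdiv; last by rewrite orderE -defG.
  rewrite orderE -defG -{1}(divnK p_dv) mulKn //.
  by rewrite divn_gt0 ?prime_gt0 // dvdn_leq.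
exists <[x ^+ p]>%G => //; rewrite mem_enum inE; apply: p_index_maximal => //.
by rewrite oxp.
Qed.

(** If all maximal subgroups were normal, one containing the normaliser of a Sylow subgroup would be
    all of [G] by the Frattini argument. So every Sylow subgroup would be normal, hence inside the
    Fitting subgroup. *)
Lemma nonnilpotent_maximal G :
  ~~ nilpotent G -> exists2 M : {group gT}, maximal M G & ~~ (M <| G).
Proof.
move=> nnG; have [/existsP[M /andP[maxM nnM]] | ] :=
    boolP [exists M : {group gT}, maximal M G && ~~ (M <| G)]; first by exists M.
move/existsPn => nM; case/negP: nnG.
suffices sGF: G \subset 'F(G) by apply: nilpotentS sGF (Fitting_nil G).
rewrite -{1}(Sylow_gen G) gen_subG; apply/bigcupsP=> P /SylowP[p p_pr sylP].
apply: Fitting_max (pgroup_nil (pHall_pgroup sylP)).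
rewrite /normal (pHall_sub sylP) /=.
have [<- | [M maxM sNM]] := maximal_exists (subsetIl G 'N(P)); first exact: subsetIr.
have := nM M; rewrite maxM /= => /negPn nsMG.
have sPM: P \subset M.
  by apply: subset_trans sNM; rewrite subsetI normG (pHall_sub sylP).
have defG := Frattini_arg nsMG (pHall_subl sPM (normal_sub nsMG) sylP).
case/negP: (proper_subn (maxgroupp maxM)).
by rewrite -{1}defG mulG_subG subxx sNM.
Qed.

Lemma nilpotent_maximal_normal G M : nilpotent G -> maximal M G -> M <| G.
Proof.
move=> nilG maxM; have prM := maxgroupp maxM; have sMG := proper_sub prM.
have := nilpotent_proper_norm nilG prM.
have [defN _ | [L maxL sNL] prN] := maximal_exists (subsetIl G 'N(M)).
  by rewrite /normal sMG; apply/setIidPl.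
have [_ /(_ _ (maxgroupp maxL))] := maxgroupP maxM.
have sML: M \subset L by apply: subset_trans sNL; rewrite subsetI sMG normG.
move/(_ sML) => defL; case/andP: prN => _ /negP[].
by rewrite -{2}defL.
Qed.

End Maximal.

(** * Core-free maximal subgroups of soluble groups *)

Section CoreFree.

Variable gT : finGroupType.
Implicit Types (G H K M N P Q V : {group gT}).

Lemma gcore_quotient_trivial G M :
  M \subset G -> gcore (M / gcore M G) (G / gcore M G) = 1.
Proof.
move=> sMG; set K := gcore M G; have nsKG: K <| G := gcore_normal sMG.
have nsCG: gcore (M / K) (G / K) <| G / K by rewrite gcore_normal ?quotientS.
have [L defC sKL nsLG] := inv_quotientN nsKG nsCG.
have sLM: L \subset M.
  rewrite -(quotientSGK _ (gcore_sub M G)) -?defC ?gcore_sub //.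
  exact: subset_trans (normal_sub nsLG) (normal_norm nsKG).
have sLK: L \subset K by apply: gcore_max => //; apply: normal_norm.
by rewrite defC; apply/trivgP; rewrite quotient_sub1 // (subset_trans sLK) ?normG.
Qed.

(** A minimal normal [V] is abelian and not inside [M], so [V * M = G] by maximality. Both [V :&: M]
    and ['C_M(V)] are then normalised by [V] and by [M], hence lie in the trivial core. *)
Lemma corefree_maximal_socle G M :
    solvable G -> maximal M G -> gcore M G = 1 ->
  exists V : {group gT}, [/\ minnormal V G, is_abelem V, V ><| M = G & 'C_G(V) = V].
Proof.
move=> solG maxM coreM; have prM := maxgroupp maxM; have sMG := proper_sub prM.
have ntG: G :!=: 1.
  by apply: contraTneq prM => ->; rewrite properE sub1G andbF.
have [V minV sVG] := minnormal_exists ntG (normG G).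
have [nVG ntV abV] := minnormal_solvable minV sVG solG.
have cVV: abelian V by case/is_abelemP: abV => p _ /abelem_abelian.
have core1 (L : {group gT}) : L \subset M -> G \subset 'N(L) -> L :=: 1.
  by move=> sLM nLG; apply/trivgP; rewrite -coreM gcore_max.
have nsVM: ~~ (V \subset M).
  by apply: contra ntV => sVM; apply/eqP/core1.
have defG: V * M = G.
  have [_ maxM'] := maxgroupP maxM.
  have sVMG: V <*> M \subset G by rewrite join_subG sVG.
  rewrite -norm_joinEr ?(subset_trans sMG) //.
  apply/eqP; rewrite eqEproper sVMG; apply: contra nsVM => prVM.
  by rewrite -(maxM' _ prVM) ?joing_subl ?joing_subr.
have tiVM: V :&: M = 1.
  apply: core1; first exact: subsetIr.
  rewrite -defG mulG_subG; apply/andP; split.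
    by rewrite cents_norm // centsC (subset_trans (subsetIl _ _) cVV).
  by rewrite normsI ?normG // (subset_trans sMG).
exists V; split=> //; first by rewrite sdprodE ?(subset_trans sMG).
have defC: 'C_G(V) = V * 'C_M(V).
  by rewrite -defG -group_modl.
suffices CM1: 'C_M(V) = 1 by rewrite defC CM1 mulg1.
apply: core1; first exact: subsetIl.
rewrite -{1}defG mulG_subG cents_norm /=; last by rewrite centsC subsetIr.
by rewrite normsI ?normG // norms_cent // (subset_trans sMG).
Qed.

(* [u |-> g ^ u] maps [V] into the coset [g V], injectively when [g] centralises
   no nontrivial element of [V]; so it hits the point of [M] in this coset. *)
Lemma mem_conj_complement G M V g :
    V ><| M = G -> g \in G -> 'C_V[g] = 1 ->
  exists2 x, x \in G & g \in M :^ x.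
Proof.
case/sdprodP=> _ defG nVM tiVM Gg C1.
have sVG: V \subset G by rewrite -defG mulG_subl.
have sMG: M \subset G by rewrite -defG mulG_subr.
have nVg: g \in 'N(V).
  by apply: subsetP Gg; rewrite -defG mulG_subG normG.
have eqcl: g ^: V = g *: V.
  apply/eqP; rewrite eqEcard; apply/andP; split.
    apply/subsetP=> _ /imsetP[u Vu ->]; rewrite mem_lcoset.
    have ->: g^-1 * g ^ u = u^-1 ^ g * u by rewrite !conjgE !mulgA.
    by rewrite groupM ?memJ_norm ?groupV.
  by rewrite card_lcoset -index_cent1 C1 indexg1.
have: g \in M * V by rewrite normC ?defG //.
case/mulsgP=> m v Mm Vv defg.
have: m \in g *: V by rewrite mem_lcoset defg invMg mulgKV groupV.
rewrite -eqcl => /imsetP[u Vu defm]; exists u^-1; first by rewrite groupV (subsetP sVG).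
by rewrite mem_conjg invgK -defm.
Qed.

(** Write [g = v * m]. As [V] and [M] are abelian, ['C_V[g] = 'C_V[m]] is normal in [G], so it is
    trivial or [V]. In the second case [m] is central, hence in the trivial core, and [g] lies in
    [V]. *)
Lemma corefree_abelian_cover G M V g :
    minnormal V G -> abelian V -> V ><| M = G -> abelian M -> gcore M G = 1 ->
    g \in G -> g \notin V ->
  exists2 x, x \in G & g \in M :^ x.
Proof.
move=> minV cVV defG cMM coreM Gg nVg.
apply: (mem_conj_complement defG) => //.
have /sdprodP[_ defG' nVM tiVM] := defG.
have /andP[ntV nVG] := mingroupp minV; have [_ minV'] := mingroupP minV.
move: Gg; rewrite -defG' => /mulsgP[v m Vv Mm defg].
have CE: 'C_V[g] = 'C_V[m].
  apply/setP=> w; rewrite 2!in_setI; apply: andb_id2l => Vw.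
  by rewrite defg ![w \in _]cent1C groupMl //; apply/cent1P/(centsP cVV).
apply/eqP; apply: contraNT nVg => ntC.
have sMCm: M \subset 'C[m] by rewrite sub_cent1 (subsetP cMM).
have nC: G \subset 'N('C_V[m]).
  rewrite -defG' mulG_subG cents_norm /=; last first.
    by rewrite centsC (subset_trans (subsetIl _ _) cVV).
  by rewrite normsI // (subset_trans sMCm) ?normG.
have CV: 'C_V[m] = V.
  by apply: minV'; rewrite /= ?subsetIl // -{1}CE ntC.
have m1: m = 1.
  apply/set1P; rewrite -[set1 _]coreM -cycle_subG gcore_max ?cycle_subG //.
  rewrite cents_norm // cent_cycle -defG' mulG_subG sMCm andbT.
  by rewrite -{1}CV subsetIr.
by rewrite defg m1 mulg1.
Qed.

Lemma corefree_normal_cover G M V g :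
    minnormal V G -> V ><| M = G -> ~~ (M <| G) ->
    (forall P, maximal P G -> ~~ (P <| G) -> #|G : M| <= #|G : P|) ->
    g \in G ->
  (exists2 x, x \in G & g \in M :^ x) \/
  (exists P, [/\ maximal P G, P <| G & g \in P]).
Proof.
move=> minV defG nnM minM Gg; have /sdprodP[_ defG' nVM tiVM] := defG.
have /andP[ntV nVG] := mingroupp minV; have [_ minV'] := mingroupP minV.
have sVG: V \subset G by rewrite -defG' mulG_subl.
have sMG: M \subset G by rewrite -defG' mulG_subr.
have [C1 | ntC] := eqVneq 'C_V[g] 1; [left | right].
  exact: mem_conj_complement defG Gg C1.
have [v /setIP[Vv cgv] ntv] := trivgPn _ ntC.
have Gv := subsetP sVG v Vv.
have Cg: g \in 'C_G[v] by rewrite inE Gg cent1C.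
have [defC | [P maxP sCP]] := maximal_exists (subsetIl G 'C[v]).
  (* A central [v] would generate [V] by minimality; then [V] would be central and [M] normal. *)
  case/negP: nnM; have cvG: G \subset 'C[v] by apply/setIidPl.
  have cvG': <[v]> \subset 'C(G) by rewrite cycle_subG -sub_cent1.
  have defV: <[v]> = V.
    apply: minV'; last by rewrite cycle_subG.
    by rewrite cycle_eq1 ntv cents_norm // centsC.
  rewrite /normal sMG -{1}defG' mulG_subG normG andbT cents_norm // -defV.
  exact: subset_trans (centS sMG).
exists P; split=> //; last exact: (subsetP sCP).
apply: contraT => nnP; have := minM P maxP nnP; rewrite leqNgt => /negP[].
have oV: #|G : M| = #|V|.
  by rewrite -divgS // -(sdprod_card defG) mulnK.
(* The class of [v] lies in [V] and misses 1, so its size, the index of the centraliser, is less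
   than [#|V|]. *)
apply: leq_ltn_trans (_ : #|G : 'C_G[v]| < _).
  by rewrite dvdn_leq // indexgS.
rewrite index_cent1 oV; apply: proper_card; apply/properP; split.
  by rewrite class_sub_norm.
exists 1; rewrite ?group1 //.
by apply: contra ntv => /imsetP[x _ /eqP]; rewrite eq_sym conjg_eq1.
Qed.

(** An element of order [p] in [M] moves some element of [V], whose orbit under it has [p] points,
    all in [V]. *)
Lemma faithful_complement_prime_le G M V p :
  V ><| M = G -> 'C_G(V) = V -> prime p -> p %| #|M| -> p <= #|V|.
Proof.
case/sdprodP=> _ defG nVM tiVM CV p_pr /Cauchy[//|x Mx ox].
have sMG: M \subset G by rewrite -defG mulG_subr.
have ncVx: ~~ (V \subset 'C[x]).
  apply/negP; rewrite sub_cent1 => cVx.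
  have: x \in V :&: M by rewrite inE Mx -CV inE cVx (subsetP sMG).
  by rewrite tiVM inE -order_eq1 ox => /eqP p1; rewrite p1 in p_pr.
have [v Vv ncvx] := subsetPn ncVx.
have C1: 'C_<[x]>[v] = 1.
  apply: prime_TIg; first by rewrite -orderE ox.
  by rewrite cycle_subG cent1C.
rewrite -ox orderE -(indexg1 <[x]>) -C1 index_cent1.
apply/subset_leq_card/subsetP=> _ /imsetP[y xy ->].
by rewrite memJ_norm // (subsetP nVM) // (subsetP _ y xy) // cycle_subG.
Qed.

End CoreFree.

(** * Coverings by the conjugates of a maximal subgroup *)

Section MaximalCovers.

Variable gT : finGroupType.
Implicit Types (G H K M N P Q V : {group gT}).

Definition normal_maximals G := [set P : {group gT} | maximal P G & P <| G].

Definition nonnormal_maximals G := [set P : {group gT} | maximal P G & ~~ (P <| G)].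

Lemma norm_nonnormal_maximal G M : maximal M G -> ~~ (M <| G) -> 'N_G(M) = M.
Proof.
move=> maxM nnM; have [prM maxM'] := maxgroupP maxM; have sMG := proper_sub prM.
have [defG | [L maxL sNL]] := maximal_exists (subsetIl G 'N(M)).
  by case/negP: nnM; rewrite /normal sMG; apply/setIidPl.
have sMN: M \subset 'N_G(M) by rewrite subsetI sMG normG.
apply/eqP; rewrite eqEsubset sMN andbT; apply: (subset_trans sNL).
by rewrite (maxM' L (maxgroupp maxL) (subset_trans sMN sNL)).
Qed.

Lemma card_maximal_conjugates G M :
  maximal M G -> ~~ (M <| G) -> #|orbit 'JG%act G M| = #|G : M|.
Proof.
by move=> maxM nnM; rewrite card_orbit astab1JG norm_nonnormal_maximal.
Qed.

Lemma conjG_orbit G M x : x \in G -> (M :^ x)%G \in orbit 'JG%act G M.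
Proof. by move=> Gx; apply/orbitP; exists x. Qed.

Lemma maximal_conjugate G M P :
  maximal M G -> P \in orbit 'JG%act G M -> maximal P G.
Proof. by move=> maxM /orbitP[x Gx <-]; rewrite /= -(conjGid Gx) maximalJ. Qed.

Lemma normal_conjugate G M P :
  P \in orbit 'JG%act G M -> (P <| G) = (M <| G).
Proof. by case/orbitP=> x Gx <-; rewrite /= -{1}(conjGid Gx) normalJ. Qed.

Lemma gcore_maximal_quotient G M (K := gcore M G) :
  maximal M G -> maximal (M / K) (G / K) /\ (M / K <| G / K) = (M <| G).
Proof.
move=> maxM; have sMG := proper_sub (maxgroupp maxM).
have nsKG: K <| G := gcore_normal sMG.
have nsKM: K <| M by apply: normalS (gcore_sub M G) sMG nsKG.
split; first by rewrite quotient_maximal.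
apply/idP/idP=> [nsMG | ]; last exact: quotient_normal.
by rewrite -(quotientGK nsKM) normal_quotient_cosetpre.
Qed.

(** This lifts the core-free case from the quotient by the core. Minimality of the index is
    inherited, since non-normal maximal subgroups of the quotient lift with the same index. *)
Lemma nonnormal_maximal_cover G M g :
    solvable G -> maximal M G -> ~~ (M <| G) ->
    (forall P, maximal P G -> ~~ (P <| G) -> #|G : M| <= #|G : P|) ->
    g \in G ->
  exists2 P : {group gT}, P \in orbit 'JG%act G M :|: normal_maximals G & g \in P.
Proof.
move=> solG maxM nnM minM Gg; have sMG := proper_sub (maxgroupp maxM).
have [maxMb nnMb] := gcore_maximal_quotient maxM.
set K := gcore M G in maxMb nnMb *.
have nsKG: K <| G := gcore_normal sMG.
have nKG := normal_norm nsKG.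
have nsKM: K <| M by apply: normalS (gcore_sub M G) sMG nsKG.
have [V [minV _ defG _]] :=
  corefree_maximal_socle (quotient_sol K solG) maxMb (gcore_quotient_trivial sMG).
have minMb (P : {group coset_of K}) : maximal P (G / K) -> ~~ (P <| G / K) ->
    #|G / K : M / K| <= #|G / K : P|.
  move=> maxP nnP; rewrite -!index_quotient_cosetpre // quotientGK //.
  by apply: minM; rewrite ?maximal_quotient_cosetpre ?normal_quotient_cosetpre.
have [| [x Gx Mg] | [P [maxP nsP Pg]]] :=
  corefree_normal_cover minV defG _ minMb (mem_quotient K Gg).
- by rewrite nnMb.
- have [y Ny Gy defx] := morphimP Gx.
  exists (M :^ y)%G; first by rewrite inE conjG_orbit.
  have: g \in coset K @*^-1 ((M / K) :^ x) by apply/morphpreP; rewrite (subsetP nKG).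
  by rewrite defx -quotientJ // quotientGK // -(normP Ny) normalJ.
exists (coset K @*^-1 P)%G; last by apply/morphpreP; rewrite (subsetP nKG).
rewrite !inE maximal_quotient_cosetpre // maxP.
by rewrite normal_quotient_cosetpre // nsP orbT.
Qed.

(** The extra subgroup is the preimage of a minimal normal subgroup of [G / gcore M G]. *)
Lemma abelian_maximal_cover G M :
    solvable G -> maximal M G -> ~~ (M <| G) -> abelian (M / gcore M G) ->
  exists2 V : {group gT}, V \proper G &
    forall g, g \in G ->
      exists2 P : {group gT}, P \in V |: orbit 'JG%act G M & g \in P.
Proof.
move=> solG maxM nnM cMM; have sMG := proper_sub (maxgroupp maxM).
have [maxMb nnMb] := gcore_maximal_quotient maxM.
have coreM1 := gcore_quotient_trivial sMG.
set K := gcore M G in maxMb nnMb cMM coreM1 *.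
have nsKG: K <| G := gcore_normal sMG.
have nKG := normal_norm nsKG.
have nsKM: K <| M by apply: normalS (gcore_sub M G) sMG nsKG.
have [V [minV abV defG _]] := corefree_maximal_socle (quotient_sol K solG) maxMb coreM1.
have cVV: abelian V by case/is_abelemP: abV => p _ /abelem_abelian.
have nsVG: V <| G / K by case/sdprod_context: defG.
exists (coset K @*^-1 V)%G.
  (* If [V] were the whole quotient, the quotient would be abelian and [M] normal. *)
  rewrite proper_quotient_cosetpre // properEneq (normal_sub nsVG) andbT.
  apply: contraNneq nnM => defV; rewrite -nnMb -sub_abelian_normal ?quotientS //.
  by rewrite -defV.
move=> g Gg; have [Vg | nVg] := boolP (coset K g \in V).
  exists (coset K @*^-1 V)%G; first by rewrite setU11.
  by apply/morphpreP; rewrite (subsetP nKG).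
have [x Gx Mg] :=
  corefree_abelian_cover minV cVV defG cMM coreM1 (mem_quotient K Gg) nVg.
have [y Ny Gy defx] := morphimP Gx.
exists (M :^ y)%G; first by rewrite !inE conjG_orbit ?orbT.
have: g \in coset K @*^-1 ((M / K) :^ x) by apply/morphpreP; rewrite (subsetP nKG).
by rewrite defx -quotientJ // quotientGK // -(normP Ny) normalJ.
Qed.

End MaximalCovers.

(** * Non-cyclic abelian groups *)

Section NoncyclicAbelian.

Variable gT : finGroupType.
Implicit Types (A G H K L M N P Q V : {group gT}).

(** Some Sylow subgroup [S] is not cyclic, so its Frattini quotient has rank at least 2. Take [L] to
    be the product of the [p']-part of [A] with a subgroup of index [p ^ 2] in [S] containing
    ['Phi(S)]. *)
Lemma noncyclic_abelian_quotient A :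
    abelian A -> ~~ cyclic A ->
  exists p L, [/\ prime p, L \subset A, p.-abelem (A / L) & #|A / L| = (p ^ 2)%N].
Proof.
move=> cAA ncA; have nilA := abelian_nil cAA.
have [p [S [p_pr sylS ncS]]] :
    exists p, exists S : {group gT}, [/\ prime p, p.-Sylow(A) S & ~~ cyclic S].
  have : ~~ Zgroup A by apply: contra ncA => ZA; apply: nil_Zgroup_cyclic.
  case/forall_inPn => S /SylowP[p p_pr sylS] ncS.
  by exists p, S.
have sSA := pHall_sub sylS; have pS := pHall_pgroup sylS.
set F := 'Phi(S); have nsFS : F <| S := Phi_normal S.
have abSF : p.-abelem (S / F) := Phi_quotient_abelem pS.
have pSF := abelem_pgroup abSF.
have lt1 : 1 < logn p #|S / F|.
  rewrite ltnNge; apply: contra ncS => le1; apply: Phi_quotient_cyclic.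
  by rewrite (abelem_cyclic abSF).
have [Qb [sQb _ oQb]] :=
  normal_pgroup pSF (normal_refl _) (leq_subr 2 (logn p #|S / F|)).
have [Q defQ sFQ sQS] := inv_quotientS nsFS sQb.
have oSQ: #|S : Q| = (p ^ 2)%N.
  rewrite -(index_quotient_eq _ sQS (normal_norm nsFS)); last first.
    by rewrite (subset_trans (subsetIr _ _)).
  rewrite -defQ -divgS // oQb {1}(card_pgroup pSF) -expnB ?prime_gt0 ?leq_subr //.
  by rewrite subKn.
have powQ x : x \in S -> x ^+ p \in Q.
  move=> Sx; have nFx : x \in 'N(F) := subsetP (normal_norm nsFS) x Sx.
  apply: (subsetP sFQ); apply: coset_idr; first exact: groupX.
  by rewrite morphX //; have [_ ->] := abelemP p_pr abSF; rewrite ?mem_quotient.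
pose C := 'O_p^'(A)%G.
have defA : S \x C = A.
  by rewrite (nilpotent_Hall_pcore nilA sylS); apply: nilpotent_pcoreC.
have [_ defA' cSC tiSC] := dprodP defA.
have cQC : C \subset 'C(Q) := subset_trans cSC (centS sQS).
have sCA : C \subset A := pcore_sub _ _.
have defL : Q \x C = (Q * C)%G.
  rewrite dprodE //; first by rewrite /= cent_joinEr.
  by apply/trivgP; rewrite -tiSC setSI.
pose L := (Q * C)%G.
have sLA : L \subset A.
  by rewrite join_subG (subset_trans sQS) ?pcore_sub ?(pHall_sub sylS).
have nsLA : L <| A by rewrite -sub_abelian_normal.
exists p, L; split=> //.
  apply/abelemP=> //; split; first exact: quotient_abelian.
  move=> _ /morphimP[x nLx Ax ->]; rewrite -morphX //; apply: coset_id.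
  move: Ax; rewrite -defA' => /mulsgP[s c Ss Cc ->].
  rewrite expgMn; last exact/commute_sym/(centsP cSC).
  apply: groupM; first by apply: (subsetP (joing_subl Q C)); apply: powQ.
  by apply: (subsetP (joing_subr Q C)); apply: groupX.
rewrite card_quotient ?normal_norm // -divgS // -(dprod_card defL) -(dprod_card defA).
by rewrite divnMr ?cardG_gt0 // divgS.
Qed.

(** The family consists of the preimages of the [p.+1] subgroups of order [p] in an elementary
    abelian quotient of order [p ^ 2]. *)
Lemma noncyclic_abelian_cover A :
    abelian A -> ~~ cyclic A ->
  exists p (F : {set {group gT}}),
    [/\ prime p, p %| #|A|, #|F| = p.+1, forall P, P \in F -> maximal P A
      & forall x, x \in A -> exists2 P, P \in F & x \in gval P].
Proof.
move=> cAA ncA.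
have [p [L [p_pr sLA abAL oAL]]] := noncyclic_abelian_quotient cAA ncA.
have nsLA : L <| A by rewrite -sub_abelian_normal.
have E2 : (A / L)%G \in 'E_p^2(A / L) by rewrite pnElemE // !inE subxx abAL oAL /=.
exists p, [set (coset L @*^-1 X)%G | X : {group coset_of L} in 'E_p^1(A / L)].
split=> //.
- by apply: dvdn_trans (dvdn_quotient A L); rewrite oAL dvdn_mulr.
- by rewrite card_imset ?(card_p1Elem_p2Elem E2) //; apply: cosetpre_group_inj.
- move=> _ /imsetP[X EX ->]; apply: p_index_maximal.
    rewrite -(quotientGK nsLA) cosetpreSK; by case/pnElemP: EX.
  rewrite index_quotient_cosetpre // -divgS; last by case/pnElemP: EX.
  by rewrite (card_p1Elem EX) oAL expnS expn1 mulKn ?prime_gt0.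
move=> x Ax; have nLx : x \in 'N(L) by apply: subsetP Ax; apply: normal_norm.
have [X EX Xx] : exists2 X : {group coset_of L}, X \in 'E_p^1(A / L) & coset L x \in X.
  have cyc (y : coset_of L) : y \in A / L -> y != 1 -> <[y]>%G \in 'E_p^1(A / L).
    move=> Ay nty; rewrite p1ElemE // !inE cycle_subG Ay /=.
    by rewrite -orderE (abelem_order_p abAL).
  have [x1 | ntx] := eqVneq (coset L x) 1; last first.
    by exists <[coset L x]>%G; rewrite ?cyc ?mem_quotient ?cycle_id.
  (* The trivial coset lies in every subgroup, so any subgroup of order [p] will do. *)
  have [y Ay nty] : exists2 y, y \in A / L & y != 1.
    by apply/trivgPn; rewrite trivg_card1 oAL neq_ltn (ltn_exp2l 0) ?prime_gt1 ?orbT.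
  by exists <[y]>%G; rewrite ?cyc // x1 group1.
by exists (coset L @*^-1 X)%G; [apply: imset_f | apply/morphpreP].
Qed.

End NoncyclicAbelian.

(** * Upper bounds for the covering number, and counts of maximal subgroups *)

Section CoveringBounds.

Variable gT : finGroupType.
Implicit Types (A G H K L M N P Q V : {group gT}).

(** One family of [p.+1] subgroups gives both bounds: its members cover [G], and they are maximal
    and normal. *)
Lemma noncyclic_quotient_cover G N :
    N <| G -> abelian (G / N) -> ~~ cyclic (G / N) ->
  exists p, [/\ prime p, p %| #|G / N|, covering_number G <= p.+1
    & p < #|normal_maximals G|].
Proof.
move=> nsNG cGN ncGN.
have [p [F [p_pr p_dv oF maxF covF]]] := noncyclic_abelian_cover cGN ncGN.
have oF' : #|[set (coset N @*^-1 X)%G | X : {group coset_of N} in F]| = p.+1.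
  by rewrite card_imset //; apply: cosetpre_group_inj.
exists p; split=> //; rewrite -oF'.
  apply: covering_number_le.
  - by apply: contra ncGN; apply: quotient_cyclic.
  - move=> _ /imsetP[X /maxF maxX ->].
    by rewrite proper_quotient_cosetpre ?(maxgroupp maxX).
  move=> x Gx; have [P FP Px] := covF _ (mem_quotient N Gx).
  exists (coset N @*^-1 P)%G; first exact: imset_f.
  by apply/morphpreP; rewrite (subsetP (normal_norm nsNG)).
apply/subset_leq_card/subsetP=> _ /imsetP[X /maxF maxX ->].
rewrite inE maximal_quotient_cosetpre // maxX normal_quotient_cosetpre //.
by rewrite -sub_abelian_normal // proper_sub ?(maxgroupp maxX).
Qed.

Lemma covering_number_min_index G M :
    solvable G -> maximal M G -> ~~ (M <| G) ->
    (forall P, maximal P G -> ~~ (P <| G) -> #|G : M| <= #|G : P|) ->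
  covering_number G <= #|G : M| + #|normal_maximals G|.
Proof.
move=> solG maxM nnM minM.
have ncG: ~~ cyclic G.
  apply: contra nnM => /cyclic_abelian cGG.
  by rewrite -sub_abelian_normal // proper_sub ?(maxgroupp maxM).
apply: leq_trans
  (covering_number_le (A := orbit 'JG%act G M :|: normal_maximals G) ncG _ _) _.
- move=> H; rewrite !inE => /orP[/(maximal_conjugate maxM) | /andP[]] maxH => [|_];
    exact: (maxgroupp maxH).
- by move=> x Gx; apply: nonnormal_maximal_cover.
by rewrite -(card_maximal_conjugates maxM nnM) cardsU leq_subr.
Qed.

Lemma covering_number_abelian_core G M :
    solvable G -> maximal M G -> ~~ (M <| G) -> abelian (M / gcore M G) ->
  covering_number G <= #|G : M|.+1.
Proof.
move=> solG maxM nnM cMM.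
have ncG: ~~ cyclic G.
  apply: contra nnM => /cyclic_abelian cGG.
  by rewrite -sub_abelian_normal // proper_sub ?(maxgroupp maxM).
have [V prV covV] := abelian_maximal_cover solG maxM nnM cMM.
apply: leq_trans (covering_number_le (A := V |: orbit 'JG%act G M) ncG _ covV) _.
  move=> H; rewrite !inE => /orP[/eqP-> // | /(maximal_conjugate maxM) maxH].
  exact: (maxgroupp maxH).
by rewrite -(card_maximal_conjugates maxM nnM) cardsU1; case: (_ \notin _).
Qed.

Lemma num_maximal_split G :
  num_maximal G = #|nonnormal_maximals G| + #|normal_maximals G|.
Proof.
rewrite /num_maximal -(cardsID [set P : {group gT} | P <| G]) addnC.
by congr (_ + _); apply: eq_card => P; rewrite !inE // andbC.
Qed.

Lemma conjugates_nonnormal_maximals G M :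
  maximal M G -> ~~ (M <| G) -> orbit 'JG%act G M \subset nonnormal_maximals G.
Proof.
move=> maxM nnM; apply/subsetP=> P MP.
by rewrite inE (maximal_conjugate maxM MP) (normal_conjugate MP).
Qed.

Lemma two_classes_nonnormal_maximals G M P :
    maximal M G -> ~~ (M <| G) -> maximal P G -> ~~ (P <| G) ->
    P \notin orbit 'JG%act G M ->
  #|G : M| + #|G : P| <= #|nonnormal_maximals G|.
Proof.
move=> maxM nnM maxP nnP nMP.
rewrite -!card_maximal_conjugates //.
rewrite -[leqLHS]subn0 -{1}(cards0 {group gT}).
have <- : orbit 'JG%act G M :&: orbit 'JG%act G P = set0.
  apply/setP=> L; rewrite !inE; apply/negP=> /andP[ML PL]; case/negP: nMP.
  by rewrite orbit_sym in PL; apply: orbit_trans PL ML.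
by rewrite -cardsU subset_leq_card // subUset !conjugates_nonnormal_maximals.
Qed.

(** The derived subgroup is proper, and a maximal subgroup containing it is normal. *)
Lemma normal_maximals_gt0 G : solvable G -> G :!=: 1 -> 0 < #|normal_maximals G|.
Proof.
move=> solG ntG; have prG := sol_der1_proper solG (subxx G) ntG.
have [defG | [M maxM sGM]] := maximal_exists (der_sub 1 G).
  by rewrite -{2}defG properxx in prG.
apply/card_gt0P; exists M; rewrite inE maxM.
by rewrite sub_der1_normal // proper_sub ?(maxgroupp maxM).
Qed.

End CoveringBounds.

(** * Consequences of having few maximal subgroups *)

Section Numeric.

Variable gT : finGroupType.
Implicit Types (A G H K L M N P Q V : {group gT}).

(** [V] is the preimage of a minimal normal subgroup of [G / gcore M G] complemented by the image of
    [M]. The complement acts faithfully on it, and its order is [#|G : M|]; this bounds the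
    primes. *)
Lemma maximal_socle_quotient G M :
    solvable G -> maximal M G ->
  exists V, [/\ V <| G, gcore M G \proper V, M / gcore M G \isog G / V
    & forall p, prime p -> p %| #|G / V| -> p <= #|G : M|].
Proof.
move=> solG maxM; have sMG := proper_sub (maxgroupp maxM).
have nsKG : gcore M G <| G := gcore_normal sMG.
have nsKM : gcore M G <| M := normalS (gcore_sub M G) sMG nsKG.
have maxMb : maximal (M / gcore M G) (G / gcore M G) by rewrite quotient_maximal.
have [V [minV _ defG CV]] := corefree_maximal_socle (quotient_sol _ solG)
  maxMb (gcore_quotient_trivial sMG).
have nsVG : V <| G / gcore M G by case/sdprod_context: defG.
have [L defV sKL nsLG] := inv_quotientN nsKG nsVG.
have {}defV : V = (L / gcore M G)%G by apply/val_inj.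
have isoMV : M / gcore M G \isog G / L.
  move: (sdprod_isog defG); rewrite defV => /isog_trans; apply.
  exact: third_isog.
exists L; split=> //.
  rewrite properEneq sKL andbT; apply/eqP=> defK.
  have /andP[/eqP[]] := mingroupp minV.
  by rewrite defV /= -defK trivg_quotient.
move=> p p_pr; rewrite -(card_isog isoMV) => p_dv.
have -> : #|G : M| = #|V|.
  rewrite -(quotientGK nsKM) index_quotient_cosetpre // -divgS ?quotientS //.
  by rewrite -(sdprod_card defG) mulnK.
exact: faithful_complement_prime_le defG CV p_pr p_dv.
Qed.

(** Choose [M] with largest core. A non-normal maximal subgroup of [G / V] would lift to one whose
    core contains [V], which is larger than the core of [M]. *)
Lemma nonnilpotent_maximal_nilpotent_quotient G :
    solvable G -> ~~ nilpotent G ->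
  exists M V, [/\ maximal M G, ~~ (M <| G), V <| G, nilpotent (G / V) &
     M / gcore M G \isog G / V /\ forall p, prime p -> p %| #|G / V| -> p <= #|G : M|].
Proof.
move=> solG nnG; have [M0 maxM0 nnM0] := nonnilpotent_maximal nnG.
case: (@arg_maxnP _ M0 (fun M : {group gT} => maximal M G && ~~ (M <| G))
  (fun M : {group gT} => #|gcore M G|)) => [|M /andP[maxM nnM] maxcore].
  by rewrite maxM0.
have [V [nsVG prKV isoMV pV]] := maximal_socle_quotient solG maxM.
exists M, V; split=> //; apply: contraT => /nonnilpotent_maximal[P maxP nnP].
have: #|gcore (coset V @*^-1 P) G| <= #|gcore M G|.
  apply: (maxcore (coset V @*^-1 P)%G).
  by rewrite maximal_quotient_cosetpre // maxP normal_quotient_cosetpre.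
rewrite leqNgt => /negP[]; apply: leq_trans (proper_card prKV) _.
apply/subset_leq_card/gcore_max; first exact: sub_cosetpre.
exact: normal_norm.
Qed.

Lemma few_maximal_subgroups G :
    ~~ nilpotent G -> solvable G ->
    num_maximal G < 2 * covering_number G - 1 ->
  exists M, [/\ maximal M G, ~~ (M <| G), cyclic (M / gcore M G) & cyclic (G / G^`(1))]
   /\ [/\ nonnormal_maximals G = orbit 'JG%act G M,
     num_maximal G = (#|G : M| + #|normal_maximals G|)%N
     & covering_number G <= #|G : M|.+1].
Proof.
move=> nnG solG; rewrite num_maximal_split => lt_m.
have ntG : G :!=: 1 by apply: contra nnG => /eqP->; apply: nilpotent1.
have n_gt0 := normal_maximals_gt0 solG ntG.
have [Q [V [maxQ nnQ nsVG nilGV [isoQ pV]]]] :=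
  nonnilpotent_maximal_nilpotent_quotient solG nnG.
have leQ : #|G : Q| <= #|nonnormal_maximals G|.
  rewrite -card_maximal_conjugates //.
  exact/subset_leq_card/conjugates_nonnormal_maximals.
have cycGV : cyclic (G / V).
  apply: contraT => ncGV.
  (* [G / D] is the abelianisation of [G / V]; it is not cyclic, as a nilpotent group with cyclic
     abelianisation is cyclic. *)
  have [D defD sVD nsDG] := inv_quotientN nsVG (der_normal 1 (G / V)).
  have isoGD : (G / V) / (G / V)^`(1) \isog G / D.
    by rewrite defD; apply: third_isog.
  have cGD : abelian (G / D) by rewrite -(isog_abelian isoGD) der_abelian.
  have ncGD : ~~ cyclic (G / D).
    rewrite -(isog_cyclic isoGD); apply: contra ncGV.
    exact: cyclic_nilpotent_quo_der1_cyclic.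
  have [p [p_pr p_dv le1 le2]] := noncyclic_quotient_cover nsDG cGD ncGD.
  have le_p : p <= #|G : Q|.
    by apply: pV p_pr _; rewrite (dvdn_trans p_dv) // -(card_isog isoGD) dvdn_quotient.
  (* Let [N] and [n] count the non-normal and the normal maximal subgroups. Then
     [N >= #|G : Q| >= p] and [n >= p + 1], so [N + n >= 2p + 1 >= 2 sigma - 1]. *)
  clear -lt_m leQ le1 le2 le_p; lia.
have cycQ : cyclic (Q / gcore Q G) by rewrite (isog_cyclic isoQ).
have leQ1 := covering_number_abelian_core solG maxQ nnQ (cyclic_abelian cycQ).
case: (@arg_minnP _ Q (fun M : {group gT} => maximal M G && ~~ (M <| G))
  (fun M : {group gT} => #|G : M|)) => [|M /andP[maxM nnM] minM].
  by rewrite maxQ.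
have minM' P : maximal P G -> ~~ (P <| G) -> #|G : M| <= #|G : P|.
  by move=> maxP nnP; rewrite minM ?maxP.
have leM1 := covering_number_min_index solG maxM nnM minM'.
have MQ : M \in orbit 'JG%act G Q.
  apply: contraT => nMQ.
  (* Adding [sigma <= #|G : Q| + 1] and [sigma <= #|G : M| + n] gives [2 sigma <= N + n + 1]. *)
  have := two_classes_nonnormal_maximals maxQ nnQ maxM nnM nMQ.
  clear -lt_m leQ1 leM1; lia.
have oQM : #|G : Q| = #|G : M|.
  by rewrite -!card_maximal_conjugates // (orbit_eqP MQ).
have defN : nonnormal_maximals G = orbit 'JG%act G Q.
  apply/eqP; rewrite eqEsubset conjugates_nonnormal_maximals // andbT.
  apply/subsetP=> P; rewrite inE => /andP[maxP nnP]; apply: contraT => nQP.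
  (* Here [N >= 2 #|G : Q| >= 2 sigma - 2] and [n >= 1]. *)
  have := two_classes_nonnormal_maximals maxQ nnQ maxP nnP nQP.
  have := minM' P maxP nnP; clear -lt_m leQ1 oQM n_gt0; lia.
exists Q; split; split=> //; last first.
  by rewrite defN card_maximal_conjugates.
apply: contraT => ncG.
have [p [_ _ le1 le2]] :=
  noncyclic_quotient_cover (der_normal 1 G) (der_abelian 0 G) ncG.
(* Here [sigma <= p + 1 <= n] and [sigma <= #|G : Q| + 1 <= N + 1]. *)
clear -lt_m leQ1 leQ le1 le2; lia.
Qed.

End Numeric.

(** * The derived subgroup as a complement to a non-normal maximal subgroup *)

Section Structure.

Variable gT : finGroupType.
Implicit Types (A G H K L M N P Q V : {group gT}).

Lemma der1_not_sub_nonnormal G M :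
  M \subset G -> ~~ (M <| G) -> ~~ (G^`(1) \subset M).
Proof. by move=> sMG; apply: contra => /sub_der1_normal; apply. Qed.

Lemma der1_mul_nonnormal_maximal G M :
  maximal M G -> ~~ (M <| G) -> G^`(1) * M = G.
Proof.
move=> maxM nnM; have [prM maxM'] := maxgroupP maxM; have sMG := proper_sub prM.
have nDM : M \subset 'N(G^`(1)) := subset_trans sMG (der_norm 1 G).
have sDMG : G^`(1) <*> M \subset G by rewrite join_subG der_sub.
rewrite -norm_joinEr //; apply/eqP; rewrite eqEproper sDMG.
apply: contra (der1_not_sub_nonnormal sMG nnM) => prDM.
by rewrite -(maxM' _ prDM (joing_subr _ _)) joing_subl.
Qed.

Lemma Phi1_mem_maximal G x :
  'Phi(G) = 1 -> x \in G -> (forall P, maximal P G -> x \in P) -> x = 1.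
Proof.
move=> Phi1 Gx maxx; apply/set1P; rewrite -[set1 _]Phi1.
by apply/bigcapP=> P /predU1P[-> | /maxx].
Qed.

(** Modulo the core, the derived subgroup lies in the minimal normal [V], whose quotient is
    isomorphic to the abelian image of [M]. It is nontrivial because [M] is not normal, so it equals
    [V]. *)
Lemma der1_abelem_quotient G M :
    solvable G -> maximal M G -> ~~ (M <| G) -> abelian (M / gcore M G) ->
  is_abelem (G^`(1) / gcore M G) /\ #|G^`(1) / gcore M G| = #|G : M|.
Proof.
move=> solG maxM nnM cMM; have sMG := proper_sub (maxgroupp maxM).
have [maxMb nnMb] := gcore_maximal_quotient maxM.
have nsKG : gcore M G <| G := gcore_normal sMG.
have nsKM : gcore M G <| M := normalS (gcore_sub M G) sMG nsKG.
have [V [minV abV defG _]] := corefree_maximal_socle (quotient_sol _ solG)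
  maxMb (gcore_quotient_trivial sMG).
have [_ minV'] := mingroupP minV; have /sdprod_context[nsV _ _ _ _] := defG.
suffices defV : G^`(1) / gcore M G = V.
  rewrite defV; split=> //.
  have -> : #|G : M| = #|G / gcore M G : M / gcore M G|.
    by rewrite -index_quotient_cosetpre // quotientGK.
  by rewrite -divgS ?quotientS // -(sdprod_card defG) mulnK.
rewrite quotient_der ?normal_norm //; apply: minV'.
  rewrite der_norm andbT; apply: contra nnM => /eqP D1.
  by rewrite -nnMb sub_der1_normal ?quotientS // D1 sub1G.
rewrite der1_min ?normal_norm //.
by rewrite -(isog_abelian (sdprod_isog defG)).
Qed.

(** * Groups with trivial Frattini subgroup and one class of non-normal maximal subgroups *)

Section FrattiniFree.

Variables (G M : {group gT}).
Hypotheses (Phi1 : 'Phi(G) = 1) (solG : solvable G) (maxM : maximal M G).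
Hypotheses (nnM : ~~ (M <| G)) (cMK : abelian (M / gcore M G)).
Hypotheses (cycG1 : cyclic (G / G^`(1))).
Hypotheses (defnn : nonnormal_maximals G = orbit 'JG%act G M).

Let sMG : M \subset G. Proof. exact: proper_sub (maxgroupp maxM). Qed.
Let nsKG : gcore M G <| G. Proof. exact: gcore_normal. Qed.

Lemma gcore_mem_nonnormal x P :
  x \in gcore M G -> maximal P G -> ~~ (P <| G) -> x \in P.
Proof.
move=> Kx maxP nnP; have: P \in nonnormal_maximals G by rewrite inE maxP.
rewrite defnn => /orbitP[y Gy <-] /=.
by apply: (subsetP (bigcap_inf y Gy)) Kx.
Qed.

(** The derived subgroup lies in every normal maximal subgroup and the core in every non-normal one,
    so the intersection lies in the Frattini subgroup. *)
Lemma der1_gcore_TI : G^`(1) :&: gcore M G = 1.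
Proof.
apply/trivgP/subsetP=> x /setIP[Dx Kx]; apply/set1P.
apply: (Phi1_mem_maximal Phi1); first by apply: (subsetP (der_sub 1 G)).
move=> P maxP; have [nsP | nnP] := boolP (P <| G); last exact: gcore_mem_nonnormal.
suffices: G^`(1) \subset P by move/subsetP->.
rewrite der1_min ?normal_norm // cyclic_abelian // prime_cyclic //.
by rewrite card_quotient ?normal_norm // normal_maximal_prime.
Qed.

Lemma gcore_central : gcore M G \subset 'C(G).
Proof.
apply/commG1P/trivgP; rewrite -der1_gcore_TI subsetI.
by rewrite /= commg_subl normal_norm ?commSg ?normal_sub.
Qed.

Lemma der1_abelem : is_abelem G^`(1) /\ #|G^`(1)| = #|G : M|.
Proof.
have [abD <-] := der1_abelem_quotient solG maxM nnM cMK.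
have isoD : G^`(1) \isog G^`(1) / gcore M G.
  apply: quotient_isog; last by rewrite setIC der1_gcore_TI.
  exact: subset_trans (der_sub 1 G) (normal_norm nsKG).
split; last exact: card_isog isoD.
case/is_abelemP: abD => p p_pr abD; apply/is_abelemP; exists p => //.
by rewrite (isog_abelem isoD).
Qed.

(** The product is [G] and the orders multiply to [#|G|], so the intersection is trivial. *)
Lemma der1_sdprod : G^`(1) ><| M = G.
Proof.
rewrite sdprodE ?der1_mul_nonnormal_maximal //.
  exact: subset_trans sMG (der_norm 1 G).
apply/cardMg_TI; rewrite der1_mul_nonnormal_maximal //.
by rewrite (proj2 der1_abelem) mulnC Lagrange.
Qed.

Lemma complement_cyclic : cyclic M.
Proof. by rewrite (isog_cyclic (sdprod_isog der1_sdprod)). Qed.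

(** The core is central. Conversely, the centraliser is normalised by the derived subgroup and by
    the abelian [M], hence by [G]. *)
Lemma cent_der1_complement : 'C_M(G^`(1)) = gcore M G.
Proof.
apply/eqP; rewrite eqEsubset subsetI gcore_sub andbC.
rewrite (subset_trans gcore_central) ?centS ?der_sub //=.
apply: gcore_max; first exact: subsetIl.
rewrite -{1}(sdprodW der1_sdprod) mulG_subG; apply/andP; split.
  by rewrite cents_norm // centsC subsetIr.
rewrite cents_norm // centsC (subset_trans (subsetIl _ _)) //.
exact/cyclic_abelian/complement_cyclic.
Qed.

(* An element of order [p] in the core lies outside some normal maximal subgroup,
   necessarily of index [p], so it is not a [p]-th power in the cyclic group [M]. *)
Lemma logn_gcore p : prime p -> p %| #|gcore M G| -> logn p #|M| = 1%N.
Proof.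
move=> p_pr /Cauchy[//|x Kx ox].
have Gx : x \in G := subsetP (normal_sub nsKG) x Kx.
have Mx : x \in M := subsetP (gcore_sub M G) x Kx.
have [P [maxP nPx]] : exists P, maximal P G /\ x \notin P.
  have: x != 1 by rewrite -order_gt1 ox prime_gt1.
  have [/existsP[P /andP[maxP nPx]] | /existsPn inP] :=
    boolP [exists P : {group gT}, maximal P G && (x \notin P)]; first by exists P.
  case/eqP; apply: (Phi1_mem_maximal Phi1 Gx) => P maxP.
  by have := inP P; rewrite maxP /= negbK.
have nsP : P <| G by apply: contraR nPx; apply: gcore_mem_nonnormal.
apply/eqP; rewrite eqn_leq; apply/andP; split; last first.
  by rewrite logn_gt0 mem_primes p_pr cardG_gt0 -ox order_dvdG.
rewrite leqNgt; apply/negP => lt1.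
have [z defM] := cyclicP complement_cyclic.
have [k defx] : exists k, x = z ^+ k by apply/cycleP; rewrite -defM.
(* Since [x ^+ p = 1], the order of [z] divides [k * p], and by assumption [p ^ 2] divides that
   order. *)
have p_dvk : p %| k.
  have : p ^ 2 %| k * p.
    rewrite (dvdn_trans (_ : _ %| #[z])) //; last first.
      by rewrite order_dvdn expgM -defx -ox expg_order.
    by rewrite orderE -defM pfactor_dvdn.
  by rewrite expnS expn1 dvdn_pmul2r ?prime_gt0.
have nPx' (y : gT) : y \in M -> y \in 'N(P).
  by move=> My; apply: subsetP (normal_norm nsP) y (subsetP sMG y My).
have p_iP : p = #|G / P|.
  have oxb : #[coset P x] = p.
    apply: nt_prime_order => //.
      by rewrite -morphX ?nPx' // -ox expg_order morph1.
    by apply: contra nPx => /eqP; apply: coset_idr; rewrite nPx'.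
  apply/eqP; rewrite -dvdn_prime2 //; first by rewrite -oxb order_dvdG // mem_quotient.
  by rewrite card_quotient ?normal_norm // normal_maximal_prime.
have Mz : z \in M by rewrite defM cycle_id.
(* As a [p]-th power, [x] has trivial image in [G / P], of order [p]. *)
case/negP: nPx; apply: coset_idr; first exact: nPx'.
rewrite defx -(divnK p_dvk) expgM {2}p_iP morphX ?nPx' ?groupX //.
by rewrite expg_cardG // mem_quotient // groupX // (subsetP sMG).
Qed.

(** The conjugates of a generator of [M], with one nontrivial element of the derived subgroup, are
    [#|G : M|.+1] elements no two of which share a proper subgroup: a proper subgroup containing a
    conjugate of the generator is the corresponding conjugate of [M]. *)
Lemma covering_number_frattini_free : #|G : M| < covering_number G.
Proof.
have ncG: ~~ cyclic G.
  apply: contra nnM => /cyclic_abelian cGG; by rewrite -sub_abelian_normal.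
have /sdprodP[_ defG _ tiEM] := der1_sdprod.
have [x defM] := cyclicP complement_cyclic.
have Mx : x \in M by rewrite defM cycle_id.
have Gx : x \in G := subsetP sMG x Mx.
have [prM maxM'] := maxgroupP maxM.
have cMx : 'C_G[x] = M.
  have [defC | [P maxP sCP]] := maximal_exists (subsetIl G 'C[x]).
    case/negP: nnM; rewrite /normal sMG cents_norm // centsC defM cycle_subG.
    by rewrite -sub_cent1; apply/setIidPl.
  have sMC : M \subset 'C_G[x].
    rewrite subsetI sMG sub_cent1 (subsetP _ _ Mx) //.
    exact/cyclic_abelian/complement_cyclic.
  have defP : P :=: M := maxM' P (maxgroupp maxP) (subset_trans sMC sCP).
  by apply/eqP; rewrite eqEsubset sMC andbT -defP.
have [y Ey nty] : exists2 y, y \in G^`(1) & y != 1.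
  apply/trivgPn; apply: contra (der1_not_sub_nonnormal sMG nnM) => /eqP->.
  exact: sub1G.
have conjP g P : g \in G -> P \proper G -> x ^ g \in P -> P :=: M :^ g.
  move=> Gg prP Pxg.
  have sMP : M \subset P :^ g^-1.
    by rewrite defM cycle_subG mem_conjgV.
  have prPg : (P :^ g^-1)%G \proper G by rewrite -(conjGid (groupVr Gg)) properJ.
  by rewrite -(maxM' _ prPg sMP) /= conjsgKV.
have nMy g : g \in G -> y \notin M :^ g.
  move=> Gg; apply: contra nty => Myg.
  have: y ^ g^-1 \in G^`(1) :&: M.
    by rewrite inE memJ_norm ?Ey -?mem_conjg // (subsetP (der_norm 1 G)) ?groupV.
  by rewrite tiEM inE conjg_eq1.
have nxy : y \notin x ^: G.
  by apply/imsetP=> [[g Gg defy]]; case/negP: (nMy g Gg); rewrite defy memJ_conjg.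
have <- : #|y |: x ^: G| = #|G : M|.+1 by rewrite cardsU1 nxy -index_cent1 cMx.
apply: covering_number_ge ncG _ _.
  rewrite subUset sub1set (subsetP (der_sub 1 G)) //= class_sub_norm ?normG //.
move=> a b P; have noy g : g \in G -> P \proper G -> y \in P -> x ^ g \notin P.
  move=> Gg prP Py; apply: contra (nMy g Gg) => Pxg; by rewrite -(conjP g P).
case/setU1P=> [-> | /imsetP[g Gg ->]]; case/setU1P=> [-> | /imsetP[h Gh ->]] // prP.
- by move=> Py Pxh; case/negP: (noy h Gh prP Py).
- by move=> Pxg Py; case/negP: (noy g Gg prP Py).
move=> Pxg Pxh; have defP := conjP g P Gg prP Pxg.
have Mxhg : x ^ (h * g^-1) \in M by rewrite conjgM -mem_conjg -defP.
have Ghg : h * g^-1 \in G by rewrite groupM ?groupV.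
(* [h * g^-1] normalises [M], which is its own normaliser and the centraliser of [x]. *)
have : h * g^-1 \in 'C_G[x].
  rewrite cMx -(norm_nonnormal_maximal maxM nnM) inE Ghg; apply/normP.
  by rewrite -(conjP _ M Ghg prM Mxhg).
case/setIP=> _ /cent1P cx.
have fx : x ^ (h * g^-1) = x by rewrite conjgE -cx mulKg.
by rewrite -{1}fx conjgM conjgKV.
Qed.

End FrattiniFree.

End Structure.

(** * Prime counts, and assembly of the decomposition *)

Lemma cyclic_Zp n : cyclic (Zp n).
(* [Zp n] is by definition trivial for [n <= 1]. *)
Proof. by rewrite /Zp; case: ifP => _; rewrite ?cyclic1 // Zp_cycle cycle_cyclic. Qed.

Lemma size_primes_coprime m n : 0 < m -> 0 < n -> coprime m n ->
  size (primes (m * n)) = size (primes m) + size (primes n).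
Proof.
move=> m_gt0 n_gt0 co_mn; rewrite -size_cat; apply/perm_size/uniq_perm.
- exact: primes_uniq.
- rewrite cat_uniq !primes_uniq andbT /= -coprime_has_primes //.
- by move=> p; rewrite mem_cat primesM.
Qed.

Lemma prod_primes_squarefree n : 0 < n -> {in primes n, forall p, logn p n = 1%N} ->
  (\prod_(p <- primes n) p)%N = n.
Proof.
move=> n_gt0 sqf; rewrite [RHS](prod_prime_decomp n_gt0) prime_decompE big_map /=.
by apply: eq_big_seq => p /sqf ->; rewrite expn1.
Qed.

(** A maximal subgroup is normal exactly when it contains the derived subgroup, since normal ones
    have prime index. *)
Lemma card_normal_maximals (gT : finGroupType) (G : {group gT}) :
  cyclic (G / G^`(1)) -> #|normal_maximals G| = size (primes #|G / G^`(1)|).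
Proof.
move=> cycG; rewrite -num_maximal_cyclic // num_maximal_quotient ?der_normal //.
apply: eq_card => P; rewrite !inE; apply: andb_id2l => maxP.
have sPG := proper_sub (maxgroupp maxP).
apply/idP/idP => [nsP | sGP]; last exact: sub_der1_normal.
rewrite der1_min ?normal_norm // cyclic_abelian // prime_cyclic //.
by rewrite card_quotient ?normal_norm // normal_maximal_prime.
Qed.

Lemma dvdn_card_Aut (gT : finGroupType) (E T : {group gT}) :
  T \subset 'N(E) -> 'C_T(E) = 1 -> #|T| %| #|Aut E|.
Proof.
move=> nET CT; apply: dvdn_trans (cardSg (Aut_conj_aut E T)).
by rewrite card_morphim ker_conj_aut (setIidPr nET) -divgI CT cards1 divn1.
Qed.

(** [E] is the derived subgroup, [C] the core of [M], [T] the Hall complement of the core in the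
    cyclic group [M], and [ps] lists the primes dividing [#|C|]. The formula for the length is over
    the integers, so its subtractions are not truncated. *)
Lemma frattini_free_case (gT : finGroupType) (G : {group gT}) :
  'Phi(G) = 1 -> ~~ nilpotent G -> solvable G ->
  num_maximal G < 2 * covering_number G - 1 ->
  covering_number G <> 3 /\
  exists (E T C : {group gT}) (p t : nat) (ps : seq nat),
    [/\ [/\ prime p, p.-abelem E & #|E| = (covering_number G - 1)%N],
        [/\ 0 < t, t %| #|Aut E| & T \isog Zp t],
        [/\ uniq ps, all prime ps, all (coprime t) ps
          & C \isog Zp (\prod_(q <- ps) q)%N],
        (size ps)%:Z%R =
          ((num_maximal G)%:Z - (num_maximal (Zp_group t))%:Z
             - (covering_number G)%:Z + 1)%R
      & (E ><| T) \x C = G].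
Proof.
move=> Phi1 nnG solG /(few_maximal_subgroups nnG solG)[M].
case=> [[maxM nnM cycMK cycG1] [defnn mG leS]].
have sMG := proper_sub (maxgroupp maxM).
have cMK := cyclic_abelian cycMK.
have ltS := covering_number_frattini_free Phi1 solG maxM nnM cMK cycG1 defnn.
have defS : covering_number G = #|G : M|.+1 by apply/eqP; rewrite eqn_leq leS.
split.
  (* If sigma were 3, [M] would have index 2 and be normal. *)
  rewrite defS => -[iM]; case/negP: nnM; exact: index2_normal.
have [/is_abelemP[p p_pr abE] oE] := der1_abelem Phi1 solG maxM nnM cMK defnn.
have defG := der1_sdprod Phi1 solG maxM nnM cMK defnn.
have cycM := complement_cyclic Phi1 solG maxM nnM cMK cycG1 defnn.
have defCK := cent_der1_complement Phi1 solG maxM nnM cMK cycG1 defnn.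
have cKG := gcore_central Phi1 maxM defnn.
have oM_p := logn_gcore Phi1 solG maxM nnM cMK cycG1 defnn.
pose K := [group of gcore M G]; pose T := 'O_\pi(K)^'(M)%G.
have sKM : K \subset M := gcore_sub M G.
(* A prime dividing [#|K|] divides [#|M|] exactly once; hence [K] is a Hall subgroup of squarefree
   order. *)
have logn1 q : prime q -> q %| #|K| -> logn q #|K| = 1%N /\ logn q #|M : K| = 0%N.
  move=> q_pr q_dv; have oM : #|M| = (#|K| * #|M : K|)%N by rewrite Lagrange.
  have := oM_p q q_pr q_dv; rewrite oM lognM ?indexg_gt0 ?cardG_gt0 //.
  have : 0 < logn q #|K| by rewrite logn_gt0 mem_primes q_pr cardG_gt0.
  by move: (logn q _) (logn q _) => a b; clear; lia.
have hallK : \pi(K).-Hall(M) K.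
  rewrite /pHall sKM pgroup_pi /=; apply/pnatP=> // q q_pr q_dv.
  rewrite !inE /= mem_primes q_pr cardG_gt0 /=; apply/negP => q_dvK.
  have [_] := logn1 q q_pr q_dvK; apply/eqP; rewrite -lt0n.
  by rewrite logn_gt0 mem_primes q_pr indexg_gt0.
have defM : K \x T = M.
  have nilM := abelian_nil (cyclic_abelian cycM).
  by rewrite {1}(nilpotent_Hall_pcore nilM hallK); apply: nilpotent_pcoreC.
have [_ defM' cKT tiKT] := dprodP defM.
have sTM : T \subset M := pcore_sub _ _.
have [_ defG' nEM tiEM] := sdprodP defG.
have nET : T \subset 'N(G^`(1)) := subset_trans sTM nEM.
have coTK : coprime #|T| #|K|.
  by rewrite coprime_sym; apply: pnat_coprime (pgroup_pi K) _; apply: pcore_pgroup.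
have co q : q \in primes #|K| -> coprime #|T| q.
  rewrite mem_primes => /and3P[q_pr _ q_dv].
  exact: coprime_dvdr q_dv coTK.
have nG : #|normal_maximals G| = (size (primes #|T|) + size (primes #|K|))%N.
  rewrite card_normal_maximals // -(card_isog (sdprod_isog defG)).
  by rewrite -(dprod_card defM) mulnC size_primes_coprime.
have mT : num_maximal (Zp_group #|T|) = size (primes #|T|).
  by rewrite num_maximal_cyclic ?cyclic_Zp // card_Zp.
exists G^`(1)%G, T, K, p, #|T|, (primes #|K|); split.
- by rewrite defS subn1.
- split=> //.
    apply: dvdn_card_Aut => //.
    (* The centraliser of the derived subgroup in [M] is [K], which meets [T] trivially. *)
    apply/trivgP; rewrite -tiKT subsetI subsetIl andbT.
    by rewrite -[gval K]defCK setSI.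
  by rewrite isog_cyclic_card ?(cyclicS sTM) // cyclic_Zp card_Zp //=.
- split; first exact: primes_uniq.
  + by apply/allP=> q; rewrite mem_primes => /and3P[].
  + by apply/allP=> q /co.
  rewrite prod_primes_squarefree // => [|q]; last first.
    by rewrite mem_primes => /and3P[q_pr _ q_dv]; case: (logn1 q q_pr q_dv).
  by rewrite isog_cyclic_card ?(cyclicS sKM) // cyclic_Zp card_Zp //=.
(* The index of [M] cancels: it is [sigma - 1], and the other maximal subgroups are counted by the
   primes of [#|T|] and of [#|K|]. *)
- rewrite mT mG nG defS.
  by move: #|G : M| (size _) (size _) => q a b; clear; lia.
have dET : G^`(1) ><| T = G^`(1) <*> T.
  rewrite sdprodEY //; apply/trivgP; by rewrite -tiEM setIS.
have oET : #|G^`(1) <*> T| = (#|G^`(1)| * #|T|)%N by rewrite (sdprod_card dET).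
have defGK : (G^`(1) <*> T) * K = G.
  by rewrite norm_joinEr // -mulgA (centC cKT) defM' defG'.
rewrite /= dET dprodE //.
  by rewrite (subset_trans cKG) ?centS // join_subG der_sub (subset_trans sTM).
apply/cardMg_TI; rewrite defGK -(sdprod_card defG) -(dprod_card defM) oET.
by rewrite mulnAC mulnA.
Qed.

Theorem corollary2p5 (gT : finGroupType) (G : {group gT}) :
  ~~ nilpotent G -> solvable G ->
  num_maximal G < 2 * covering_number G - 1 ->
  covering_number G <> 3 /\
  exists (hT : finGroupType) (E T C H : {group hT})
         (p t : nat) (ps : seq nat),
    [/\ [/\ prime p, p.-abelem E & #|E| = (covering_number G - 1)%N],
        [/\ 0 < t, t %| #|Aut E| & T \isog Zp t],
        [/\ uniq ps, all prime ps, all (coprime t) ps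
          & C \isog Zp (\prod_(q <- ps) q)%N],
        (size ps)%:Z%R =
          ((num_maximal G)%:Z - (num_maximal (Zp_group t))%:Z
             - (covering_number G)%:Z + 1)%R
      & (E ><| T) \x C = H /\ G / 'Phi(G) \isog H].
Proof.
move=> nnG solG; have nsPhi := Phi_normal G.
(* A non-normal maximal subgroup contains the Frattini subgroup, so its image in the quotient is
   still maximal and not normal. *)
have nnGb : ~~ nilpotent (G / 'Phi(G)).
  have [M maxM nnM] := nonnilpotent_maximal nnG.
  have sMG := proper_sub (maxgroupp maxM).
  have nsPhiM : 'Phi(G) <| M := normalS (Phi_sub_max maxM) sMG nsPhi.
  apply: contra nnM => nilGb; rewrite -(quotientGK nsPhiM) normal_quotient_cosetpre //.
  by apply: nilpotent_maximal_normal nilGb _; rewrite quotient_maximal.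
rewrite -num_maximal_quotient_Phi -covering_number_quotient_Phi => lt_m.
have [nS [E [T [C [p [t [ps [hE hT hC hps defG]]]]]]]] :=
  frattini_free_case (Phi_quotient_id G) nnGb (quotient_sol _ solG) lt_m.
split=> //; exists (coset_of 'Phi(G)), E, T, C, (G / 'Phi(G))%G, p, t, ps.
by split=> //; split=> //; apply: isog_refl.
Qed.
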